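(* Let $(S,\tau)$ be a topological semigroup. Then $(S,\tau)$ is a band of topological groups if and only if $S$ is a topological cryptogroup satisfying the following property: for each $x\in S$ and each open set $G$ in $S$ containing $x$ there is an open set $U$ in $S$ such that $x\in U\subseteq G\cap H_x$.
   Context: A topological semigroup is a semigroup $S$ with a topology such that $(x,y)\mapsto xy$, $S\times S\to S$, is continuous. A semigroup $S$ is completely regular if for each $a\in S$ there is $x\in S$ with $a=axa$ and $ax=xa$. In such a semigroup (as in any semigroup in which every element $a$ satisfies $axa=a$ for some $x$), Green's relations are: $a\,\mathcal{L}\,b$ iff $Sa=Sb$; $a\,\mathcal{R}\,b$ iff $aS=bS$; $\mathcal{H}=\mathcal{L}\cap\mathcal{R}$. A cryptogroup is a completely regular semigroup in which $\mathcal{H}$ is a congruence. In a cryptogroup, $H_x$ is the $\mathcal{H}$-class of $x$ (a group), $x^0$ is the identity of $H_x$, and $x^{-1}$ is the inverse of $x$ in the group $H_x$. A topological cryptogroup is a topological semigroup which is a cryptogroup and for which $x\mapsto x^{-1}$ is continuous. A band is a semigroup in which every element is idempotent; a band congruence on $S$ is a congruence $\rho$ with $S/\rho$ a band. A topological semigroup $(S,\tau)$ is a band $B$ of topological groups $(G_\alpha,\tau_\alpha)$ $(\alpha\in B)$ if $S$ admits a band congruence $\rho$ such that $S/\rho=B$, each $G_\alpha$ is a topological group (under the operation of $S$ and the topology $\tau_\alpha$) that is the $\rho$-class mapped onto $\alpha$ by the natural epimorphism $S\to B$, and $\bigcup_{\alpha\in B}\tau_\alpha$ is a base for $\tau$.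 ''Band of topological groups'' means a band $B$ of topological groups for some $B$ and some $(G_\alpha,\tau_\alpha)$. *)

(* Defs.v *)
From HB Require Import structures.
From Corelib Require Import RelationClasses.
From mathcomp Require Import all_boot generic_quotient.
From mathcomp Require Import boolp classical_sets topology.

Set Implicit Arguments.
Unset Strict Implicit.
Unset Printing Implicit Defensive.

Local Open Scope classical_set_scope.
Local Open Scope quotient_scope.
Local Open Scope group_scope.

HB.mixin Record hasContinuousMul S of Semigroup S & Topological S := {
  mul_continuous : continuous (fun p : S * S => p.1 * p.2)
}.

#[short(type="topologicalSemigroupType")]
HB.structure Definition TopologicalSemigroup :=
  {S of Semigroup S & Topological S & hasContinuousMul S}.

HB.mixin Record hasContinuousInv G of Group G & Topological G := {
  inv_continuous : continuous (fun x : G => x^-1)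
}.

#[short(type="topologicalGroupType")]
HB.structure Definition TopologicalGroup :=
  {G of Group G & TopologicalSemigroup G & hasContinuousInv G}.

Definition band (S : semigroupType) := forall x : S, x * x = x.

Definition is_congruence (S : semigroupType) (r : S -> S -> Prop) :=
  Equivalence r /\
  forall c a b, r a b -> r (c * a) (c * b) /\ r (a * c) (b * c).

Record congruence (S : semigroupType) :=
  Congruence { cong_rel :> S -> S -> Prop; congP : is_congruence cong_rel }.

Section Quotient.
Variables (S : semigroupType) (rho : congruence S).

Lemma cong_equiv : equiv_class_of (fun x y : S => `[< rho x y >]).
Proof.
have [[refl sym trans] _] := congP rho.
split=> [x|x y|y x z]; first exact/asboolP/refl.
- by apply/asboolP/asboolP; exact: sym.
- by move=> /asboolP xy /asboolP yz; apply/asboolP/(trans x y z).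
Qed.

Definition quotient := {eq_quot EquivRelPack cong_equiv}.
HB.instance Definition _ := Choice.on quotient.
HB.instance Definition _ := Quotient.on quotient.
HB.instance Definition _ := EqQuotient.on quotient.

Lemma quotientP (x y : S) : \pi_quotient x = \pi_quotient y <-> rho x y.
Proof. by split=> [/eqquotP/asboolP//|xy]; apply/eqquotP/asboolP. Qed.

Definition quotient_mul (a b : quotient) : quotient :=
  \pi_quotient (repr a * repr b).

Lemma quotient_mulE (x y : S) :
  quotient_mul (\pi_quotient x) (\pi_quotient y) = \pi_quotient (x * y).
Proof.
have [[_ _ trans] compat] := congP rho; apply/quotientP.
apply: (trans _ (x * repr (\pi_quotient y))).
  by apply: (compat _ _ _ _).2; apply/quotientP; rewrite reprK.
by apply: (compat _ _ _ _).1; apply/quotientP; rewrite reprK.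
Qed.

Lemma quotient_mulA : associative quotient_mul.
Proof.
elim/quotW=> x; elim/quotW=> y; elim/quotW=> z.
by rewrite (quotient_mulE y z) (quotient_mulE x y) !quotient_mulE mulgA.
Qed.

HB.instance Definition _ := isSemigroup.Build quotient quotient_mulA.
End Quotient.

Section BandOfTopologicalGroups.
Variables (S : topologicalSemigroupType) (rho : congruence S).
Variables (G : quotient rho -> topologicalGroupType).
Variables (incl : forall alpha, G alpha -> S).

(* G alpha lives on its own type; incl identifies it, operation included, with
   the rho-class alpha of S. Its topology tau_alpha is arbitrary: only the base
   condition relates it to that of S. *)
Definition band_of :=
  [/\ band (quotient rho),
      forall alpha,
        [/\ injective (@incl alpha),
            {morph @incl alpha : x y / x * y >-> x * y} &
            range (@incl alpha) = [set x | \pi_(quotient rho) x = alpha]] &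
      basis (\bigcup_alpha [set @incl alpha @` V | V in open])].
End BandOfTopologicalGroups.

Definition band_of_topological_groups (S : topologicalSemigroupType) :=
  exists (rho : congruence S) (G : quotient rho -> topologicalGroupType)
    (incl : forall alpha, G alpha -> S), band_of incl.

Section Cryptogroups.
Variable S : semigroupType.
Implicit Types a b x y e : S.

Definition completely_regular :=
  forall a, exists x, a = a * x * a /\ a * x = x * a.

(* Sa = Sb and aS = bS, with no identity adjoined to S: these are Green's
   relations when every a satisfies axa = a for some x. *)
Definition greenL a b := range (fun s => s * a) = range (fun s => s * b).
Definition greenR a b := range (fun s => a * s) = range (fun s => b * s).
Definition greenH a b := greenL a b /\ greenR a b.

Definition cryptogroup := completely_regular /\ is_congruence greenH.

Definition Hclass x : set S := [set y | greenH x y].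

(* The identity x^0 of the group Hclass x and the inverse x^{-1} of x in it,
   with junk value x where they do not exist (see Hid_spec, Hinv_spec). *)
Definition Hid x : S :=
  xget x [set e | Hclass x e /\ forall y, Hclass x y -> e * y = y /\ y * e = y].
Definition Hinv x : S :=
  xget x [set y | [/\ Hclass x y, x * y = Hid x & y * x = Hid x]].

Lemma Hclass_group : completely_regular -> forall a, exists e y,
  [/\ Hclass a e, forall b, Hclass a b -> e * b = b /\ b * e = b,
      Hclass a y, a * y = e & y * a = e].
Proof.
move=> cr a; have [x [axa ax]] := cr a.
have xaa : x * a * a = a by rewrite -ax -axa.
have aax : a * a * x = a by rewrite -mulgA ax mulgA -axa.
have aay : a * a * (x * a * x) = a by rewrite !mulgA aax aax.
have yaa : x * a * x * a * a = a.
  by rewrite -(mulgA (x * a)) -(mulgA (x * a)) xaa xaa.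
have eH : Hclass a (a * x).
  split; apply/seteqP; split=> _ [s _ <-].
  - by exists (s * a) => //; rewrite -mulgA (mulgA a) aax.
  - by exists (s * x) => //; rewrite -mulgA ax.
  - by exists (a * s) => //; rewrite mulgA -axa.
  - by exists (x * s) => //; rewrite mulgA.
exists (a * x), (x * a * x); split=> //.
- move=> b [Lab Rab]; have [z [bzb bz]] := cr b.
  have : range (fun s => a * s) b.
    by rewrite Rab; exists (z * b) => //; rewrite mulgA.
  have : range (fun s => s * a) b by rewrite Lab; exists (b * z).
  move=> [s _ sa] [t _ at_]; split; first by rewrite -at_ mulgA -axa.
  by rewrite -sa -mulgA (mulgA a) aax.
- split; apply/seteqP; split=> _ [s _ <-].
  + by exists (s * a * a) => //; rewrite -!(mulgA s) aay.
  + by exists (s * x * x) => //; rewrite -(mulgA x) ax !mulgA.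
  + by exists (a * a * s) => //; rewrite !mulgA yaa.
  + by exists (x * x * s) => //; rewrite -ax !mulgA.
- by rewrite !mulgA -axa.
- by rewrite -(mulgA x) -(mulgA x) -axa ax.
Qed.

Lemma Hid_spec : completely_regular -> forall x,
  Hclass x (Hid x) /\
  forall y, Hclass x y -> Hid x * y = y /\ y * Hid x = y.
Proof.
move=> cr x; have [e [y [He idH _ _ _]]] := Hclass_group cr x.
exact: (@xgetI _ x [set e | Hclass x e /\
  forall y, Hclass x y -> e * y = y /\ y * e = y] e).
Qed.

Lemma Hinv_spec : completely_regular -> forall x,
  [/\ Hclass x (Hinv x), x * Hinv x = Hid x & Hinv x * x = Hid x].
Proof.
move=> cr x; have [e [y [He idH Hy xy yx]]] := Hclass_group cr x.
have [Hid0 idE] := Hid_spec cr x.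
have eE : e = Hid x by rewrite -(idH _ Hid0).1 (idE _ He).2.
apply: (@xgetI _ x [set y | [/\ Hclass x y, x * y = Hid x & y * x = Hid x]] y).
by rewrite /= -eE.
Qed.
End Cryptogroups.

Definition topological_cryptogroup (S : topologicalSemigroupType) :=
  cryptogroup S /\ continuous (@Hinv S).

(* Main.v *)
Require Import Defs.
From HB Require Import structures.
From mathcomp Require Import all_boot generic_quotient boolp classical_sets functions topology.

Set Implicit Arguments.
Unset Strict Implicit.
Unset Printing Implicit Defensive.

Local Open Scope classical_set_scope.
Local Open Scope quotient_scope.

(** The algebraic heart is that Green's relation H is the only congruence that
    can exhibit S as a band of groups.  If the classes of a band congruence are
    groups, then two elements of one class divide each other on both sides,
    hence are H-related; conversely H-related elements have images in the
    quotient band that are both L- and R-related, and in a band that forces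
    equality ([greenH_band_congruence]).  So a band of groups is a cryptogroup,
    whose H-classes are the given groups; conversely H on a cryptogroup is a
    band congruence whose classes are groups ([cryptogroup_quotient_band]).

    Topologically, if the open sets of the groups form a base for S, then every
    H-class is open, which is what the neighbourhood property expresses, and
    inversion is continuous on S because it is so on each of these open pieces
    ([band_of_topological_groups_cryptogroup]).  Conversely, give each H-class
    the topology induced by S: continuity of multiplication and inversion passes
    to it, and, the classes being open, its open sets are the open sets of S
    that it contains, so that together they form a base
    ([topological_cryptogroup_band]). *)

(** * Inverses in completely regular semigroups *)

Lemma Hid_eq (S : semigroupType) : completely_regular S ->
  forall x y : S, greenH x y -> Hid x = Hid y.
Proof.
move=> cr x y [Lxy Rxy].
have [[Lx Rx] idx] := Hid_spec cr x; have [[Ly Ry] idy] := Hid_spec cr y.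
have xHy : Hclass x (Hid y)
  by split; [rewrite /greenL Lxy|rewrite /greenR Rxy].
have yHx : Hclass y (Hid x)
  by split; [rewrite /greenL -Lxy|rewrite /greenR -Rxy].
by rewrite -(idx _ xHy).1 (idy _ yHx).2.
Qed.

Lemma idempotent_Hid (S : semigroupType) : completely_regular S ->
  forall e : S, (e * e = e)%g -> Hid e = e.
Proof.
move=> cr e ee; have [_ _ ve] := Hinv_spec cr e.
have [_ idE] := Hid_spec cr e.
by rewrite -[RHS](idE e _).1 // -ve -mulgA ee.
Qed.

(** In a group the identity is the only idempotent, so [x * y] being idempotent
    already makes [y] the inverse of [x]. *)
Lemma Hinv_unique (S : semigroupType) : completely_regular S ->
  forall x y : S, greenH x y -> greenH x (x * y)%g ->
  (x * y * (x * y) = x * y)%g -> Hinv x = y.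
Proof.
move=> cr x y xy xxy idem; have [Hv _ vx] := Hinv_spec cr x.
have [_ idE] := Hid_spec cr x.
rewrite -(idE _ Hv).2 (Hid_eq cr xxy) (idempotent_Hid cr idem).
by rewrite mulgA vx (idE _ xy).1.
Qed.

(** * Band congruences with group classes *)

(** Divisibility on both sides within a class is all that its being a group
    contributes: it puts each class inside an H-class, and, taken at [x = y], it
    gives [x] in [Sx] and in [xS], so that the Green relations of S, defined
    without adjoining an identity, do express divisibility. *)
Lemma greenH_band_congruence (S : semigroupType) (rho : congruence S) :
  band (quotient rho) ->
  (forall x y, rho x y ->
     (exists s, s * y = x)%g /\ (exists s, y * s = x)%g) ->
  forall x y, greenH x y <-> rho x y.
Proof.
move=> bandQ divr x y; have [[refl sym _] _] := congP rho.
have piM a b : (\pi_(quotient rho) (a * b) =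
    \pi_(quotient rho) a * \pi_(quotient rho) b)%g.
  by rewrite -quotient_mulE.
split=> [[Lxy Rxy]|xy].
- have [[s sx] _] := divr _ _ (refl x); have [_ [t yt]] := divr _ _ (refl y).
  have [a _ ax] : range (fun s => s * y)%g x by rewrite -Lxy; exists s.
  have [b _ yb] : range (fun s => x * s)%g y by rewrite Rxy; exists t.
  apply/quotientP.
  (* the product of the two images equals each of them *)
  transitivity (\pi_(quotient rho) x * \pi_(quotient rho) y)%g.
    by rewrite -ax piM -mulgA bandQ.
  by rewrite -yb piM mulgA bandQ.
- have [[a ax] [b xb]] := divr _ _ xy.
  have [[c cy] [d yd]] := divr _ _ (sym _ _ xy).
  split; apply/seteqP; split=> _ [s _ <-].
  + by exists (s * a)%g => //; rewrite -mulgA ax.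
  + by exists (s * c)%g => //; rewrite -mulgA cy.
  + by exists (b * s)%g => //; rewrite mulgA xb.
  + by exists (d * s)%g => //; rewrite mulgA yd.
Qed.

(** With H identified as the given congruence, [Hinv] is the inverse of the
    groups, and both topological claims are read off basic open sets, each of
    which lies in one class. *)
Lemma band_of_topological_groups_cryptogroup (S : topologicalSemigroupType) :
  band_of_topological_groups S ->
  topological_cryptogroup S /\
  (forall (x : S) (G : set S), open G -> G x ->
     exists U : set S, [/\ open U, U x & U `<=` G `&` Hclass x]).
Proof.
move=> [rho [G [i [bandQ gr [op nb]]]]].
have iM al (g h : G al) : (i al (g * h) = i al g * i al h)%g.
  by have [_ -> _] := gr al.
have piI al (g : G al) : \pi_(quotient rho) (i al g) = al.
  have [_ _ rg] := gr al.
  suff: [set x | \pi_(quotient rho) x = al] (i al g) by [].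
  by rewrite -rg; exists g.
have rI al (g h : G al) : rho (i al g) (i al h).
  by apply/quotientP; transitivity al; rewrite ?piI.
have iS x y : rho x y -> exists al (g h : G al), x = i al g /\ y = i al h.
  move/quotientP => xy; have [_ _ rg] := gr (\pi_(quotient rho) x).
  have [g _ gx] : range (i (\pi_(quotient rho) x)) x by rewrite rg.
  have [h _ hy] : range (i (\pi_(quotient rho) x)) y by rewrite rg /= xy.
  by exists (\pi_(quotient rho) x), g, h.
have HE : forall x y, greenH x y <-> rho x y.
  apply: greenH_band_congruence => // x y /iS [al [g [h [-> ->]]]].
  split; first by exists (i al (g * h^-1)%g); rewrite -iM mulgVK.
  by exists (i al (h^-1 * g)%g); rewrite -iM mulVKg.
have [eqrho compat] := congP rho; have [refl sym trans] := eqrho.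
have iS1 x : exists al (g : G al), x = i al g.
  by have [al [g [_ [-> _]]]] := iS _ _ (refl x); exists al, g.
have cr : completely_regular S.
  move=> x; have [al [g ->]] := iS1 x.
  by exists (i al g^-1%g); rewrite -!iM mulgV mulVg mul1g.
have HinvE al (g : G al) : Hinv (i al g) = i al g^-1%g.
  apply: Hinv_unique => //; rewrite -?iM; [exact/HE|exact/HE|].
  by rewrite mulgV mulg1.
have base x (W : set S) : open W -> W x -> exists al (g : G al) (V : set (G al)),
    [/\ x = i al g, open V, V g & i al @` V `<=` W].
  move=> oW Wx; have [] := nb x W; first exact: open_nbhs_nbhs.
  move=> _ [[al _ [V oV <-]] [g Vg gx]] VW.
  by exists al, g, V; split.
have iop al (V : set (G al)) : open V -> open (i al @` V).
  by move=> oV; apply: op; exists al => //; exists V.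
split; last first.
  move=> x W oW Wx; have [al [g [V [xE oV Vg VW]]]] := base _ _ oW Wx.
  exists (i al @` V); split; [exact: iop|by rewrite xE; exists g|].
  move=> y Vy; split; first exact: VW.
  by case: Vy => h _ <-; apply/HE; rewrite xE; exact: rI.
split; first split=> //; first split.
- split=> [x|x y|x y z]; rewrite ?HE; [exact: refl|exact: sym|exact: trans].
- by move=> c a b /HE/(compat c) [? ?]; split; exact/HE.
move=> x; have [al [g ->]] := iS1 x.
move=> W; rewrite nbhsE => -[O [oO Ox] OW].
have [be [h [V [xE oV Vh VO]]]] := base _ _ oO Ox.
have abE : be = al by rewrite -(piI be h) -xE HinvE piI.
subst be; have hE : h = g^-1%g.
  by have [inj _ _] := gr al; apply: inj; rewrite -xE HinvE.
(* the inverses of the points of V form the neighbourhood sought *)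
rewrite nbhs_simpl nbhsE; exists (i al @` ((fun u => u^-1)%g @^-1` V)).
  split; last by exists g; rewrite //= -hE.
  by apply: iop; apply: open_comp oV => u _; exact: inv_continuous.
by move=> _ [u Vu <-]; apply: OW; rewrite HinvE; apply: VO; exists u^-1%g.
Qed.

(** * The H-classes of a topological cryptogroup *)

Definition Hcong (S : semigroupType) (cS : cryptogroup S) : congruence S :=
  @Congruence S (@greenH S) cS.2.

(** [x] is H-related to the idempotent [Hid x], hence, by compatibility,
    [x * x] is to [x * Hid x = x]. *)
Lemma cryptogroup_quotient_band (S : semigroupType) (cS : cryptogroup S) :
  band (quotient (Hcong cS)).
Proof.
elim/quotW=> x; rewrite [LHS]quotient_mulE; apply/quotientP => /=.
have [xe idE] := Hid_spec cS.1 x; have [_ compat] := cS.2.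
by rewrite -[X in greenH _ X](idE x _).2 //; exact: (compat x _ _ xe).1.
Qed.

Section HclassTopologicalGroup.
Variables (S : topologicalSemigroupType) (tcS : topological_cryptogroup S).
Implicit Type al : quotient (Hcong tcS.1).

Definition Hcong_class al : set S :=
  [set x | \pi_(quotient (Hcong tcS.1)) x = al].

(** An alias of the subtype of an H-class, so that the structures below, which
    depend on [tcS], are attached to it and not to every subtype of S; the
    topology is the one induced by S. *)
Definition Hsub al : Type := Hcong_class al.
HB.instance Definition _ al := Topological.on (Hsub al).

Definition Hsub_of al x (xal : Hcong_class al x) : Hsub al :=
  exist _ x (mem_set xal).

Definition Hincl al (x : Hsub al) : S := set_val x.

Lemma Hincl_inj al : injective (@Hincl al).
Proof. exact: val_inj. Qed.

Lemma Hincl_class al (x : Hsub al) : Hcong_class al (Hincl x).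
Proof. exact: set_valP. Qed.

Lemma range_Hincl al : range (@Hincl al) = Hcong_class al.
Proof.
apply/seteqP; split=> [_ [x _ <-]|x xal]; first exact: Hincl_class.
by exists (Hsub_of xal).
Qed.

Lemma Hincl_continuous al : continuous (@Hincl al).
Proof. exact: initial_continuous. Qed.

(** Universal property of the induced topology: continuity of the operations on
    an H-class is checked in S. *)
Lemma continuous_Hincl al (T : topologicalType) (f : T -> Hsub al) :
  continuous (@Hincl al \o f) -> continuous f.
Proof. exact: continuous_comp_initial. Qed.

Lemma Hincl_greenH al (x y : Hsub al) : greenH (Hincl x) (Hincl y).
Proof.
by apply/(quotientP (Hcong tcS.1)); rewrite [LHS]Hincl_class [RHS]Hincl_class.
Qed.

Lemma Hcong_class_mul al x y :
  Hcong_class al x -> Hcong_class al y -> Hcong_class al (x * y)%g.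
Proof.
rewrite /Hcong_class /= -quotient_mulE => -> ->.
exact: cryptogroup_quotient_band.
Qed.

Lemma Hcong_class_greenH al x y :
  Hcong_class al x -> greenH x y -> Hcong_class al y.
Proof. by move=> <- xy; apply/esym/(quotientP (Hcong tcS.1)). Qed.

(** [Hid] is constant on an H-class, so its value at the representative of [al]
    is the identity of the whole class. *)
Lemma Hcong_class_Hid al : Hcong_class al (Hid (repr al)).
Proof.
apply: (@Hcong_class_greenH _ (repr al)); first exact: reprK.
exact: (Hid_spec tcS.1.1 _).1.
Qed.

Lemma Hcong_class_Hinv al x : Hcong_class al x -> Hcong_class al (Hinv x).
Proof.
move=> xal; apply: Hcong_class_greenH xal _.
by have [] := Hinv_spec tcS.1.1 x.
Qed.

Definition Hsub_mul al (x y : Hsub al) : Hsub al :=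
  Hsub_of (Hcong_class_mul (Hincl_class x) (Hincl_class y)).
Definition Hsub_one al : Hsub al := Hsub_of (Hcong_class_Hid al).
Definition Hsub_inv al (x : Hsub al) : Hsub al :=
  Hsub_of (Hcong_class_Hinv (Hincl_class x)).

Lemma Hsub_mulA al : associative (@Hsub_mul al).
Proof. by move=> x y z; apply: val_inj; rewrite /= mulgA. Qed.

Lemma Hsub_Hid al (x : Hsub al) : Hid (Hincl x) = Hid (repr al).
Proof.
apply: (Hid_eq tcS.1.1); apply/(quotientP (Hcong tcS.1)).
by rewrite [LHS]Hincl_class reprK.
Qed.

Lemma Hsub_idE al (x : Hsub al) :
  (Hid (repr al) * Hincl x = Hincl x /\
   Hincl x * Hid (repr al) = Hincl x)%g.
Proof.
by rewrite -(Hsub_Hid x); apply: (Hid_spec tcS.1.1 _).2; split.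
Qed.

Lemma Hsub_mul1 al : left_id (Hsub_one al) (@Hsub_mul al).
Proof. by move=> x; apply: val_inj; exact: (Hsub_idE x).1. Qed.

Lemma Hsub_mulr1 al : right_id (Hsub_one al) (@Hsub_mul al).
Proof. by move=> x; apply: val_inj; exact: (Hsub_idE x).2. Qed.

Lemma Hsub_mulV al : left_inverse (Hsub_one al) (@Hsub_inv al) (@Hsub_mul al).
Proof.
move=> x; apply: val_inj; have [_ _ vx] := Hinv_spec tcS.1.1 (Hincl x).
by rewrite /= vx Hsub_Hid.
Qed.

Lemma Hsub_mulrV al : right_inverse (Hsub_one al) (@Hsub_inv al) (@Hsub_mul al).
Proof.
move=> x; apply: val_inj; have [_ xv _] := Hinv_spec tcS.1.1 (Hincl x).
by rewrite /= xv Hsub_Hid.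
Qed.

HB.instance Definition _ al := isGroup.Build (Hsub al) (@Hsub_mulA al)
  (@Hsub_mul1 al) (@Hsub_mulr1 al) (@Hsub_mulV al) (@Hsub_mulrV al).

Lemma Hsub_mul_continuous al :
  continuous (fun p : Hsub al * Hsub al => (p.1 * p.2)%g).
Proof.
apply: continuous_Hincl => p.
apply: (@continuous_comp _ _ _
  (fun p : Hsub al * Hsub al => (Hincl p.1, Hincl p.2))
  (fun q : S * S => (q.1 * q.2)%g)); last exact: mul_continuous.
apply: cvg_pair.
- by apply: continuous_comp; [exact: cvg_fst|exact: Hincl_continuous].
- by apply: continuous_comp; [exact: cvg_snd|exact: Hincl_continuous].
Qed.

HB.instance Definition _ al :=
  hasContinuousMul.Build (Hsub al) (@Hsub_mul_continuous al).

Lemma Hsub_inv_continuous al : continuous (fun x : Hsub al => x^-1%g).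
Proof.
apply: continuous_Hincl => x.
by apply: (@continuous_comp _ _ _ (@Hincl al) (@Hinv S));
  [exact: Hincl_continuous|exact: tcS.2].
Qed.

HB.instance Definition _ al :=
  hasContinuousInv.Build (Hsub al) (@Hsub_inv_continuous al).

(** The neighbourhood property makes every H-class open; the image in S of a set
    open in a class is then an intersection of two open sets. *)
Lemma topological_cryptogroup_band :
  (forall (x : S) (G : set S), open G -> G x ->
     exists U : set S, [/\ open U, U x & U `<=` G `&` Hclass x]) ->
  band_of_topological_groups S.
Proof.
move=> locH.
have openH al : open (Hcong_class al).
  rewrite openE => x xal; have [U [oU Ux UH]] := locH x setT openT I.
  rewrite /interior nbhsE; exists U => // y /UH [_ xy].
  exact: Hcong_class_greenH xal xy.
exists (Hcong tcS.1), (fun al => Hsub al : topologicalGroupType), Hincl.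
split=> [|al|]; first exact: cryptogroup_quotient_band.
  by split; [exact: Hincl_inj| |exact: range_Hincl].
have imE al (O : set S) :
    @Hincl al @` (@Hincl al @^-1` O) = O `&` Hcong_class al.
  rewrite -range_Hincl; apply/seteqP; split=> [_ [x Ox <-]|y [Oy [x _ xE]]].
    by split; [exact: Ox|exists x].
  by exists x => //; rewrite /= xE.
split=> [_ [al _ [_ [O oO <-] <-]]|x W].
  by rewrite imE; exact: openI.
rewrite nbhsE => -[O [oO Ox] OW].
exists (O `&` Hcong_class (\pi_(quotient (Hcong tcS.1)) x)).
  split; last by split.
  eexists; first by []. eexists; last exact: imE.
  by exists O.
by move=> y [Oy _]; exact: OW.
Qed.
End HclassTopologicalGroup.

Theorem theorem2p5 (S : topologicalSemigroupType) :
  band_of_topological_groups S <->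
  topological_cryptogroup S /\
  (forall (x : S) (G : set S), open G -> G x ->
     exists U : set S, [/\ open U, U x & U `<=` G `&` Hclass x]).
Proof.
split; first exact: band_of_topological_groups_cryptogroup.
by move=> [tcS]; exact: topological_cryptogroup_band.
Qed.
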